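(* Let $(c_\nu)_{\nu\in\mathbb{Z}_{\ge 0}^7}$ be a family of octonions and let $$\sigma=\limsup_{n\to\infty}\Bigl(\sum_{\substack{\nu=(n_1,\dots,n_7)\\ n_1+\cdots+n_7=n}}\binom{n}{\nu}\Bigl\|\frac{c_\nu}{n!}\Bigr\|\Bigr)^{1/n}.$$ Then the series $$h(x)=\sum_{n=0}^\infty\ \sum_{\substack{\nu=(n_1,\dots,n_7)\\ n_1+\cdots+n_7=n}} V_\nu(x)\, c_\nu$$ converges compactly on $\{x\in O : \|x\|_O'<\tfrac1\sigma\}$.
   Context: $O$ denotes the octonions: the real vector space with basis $e_0,e_1,\dots,e_7$ and bilinear product $e_0e_j=e_j$, $e_ie_0=e_i$, and $e_ie_j=-\delta_{ij}e_0+\sum_{k=1}^{7}\varepsilon_{ijk}e_k$ for $i,j\in\{1,\dots,7\}$, where $\delta_{ij}$ is the Kronecker delta and $\varepsilon_{ijk}$ is the completely antisymmetric tensor equal to $+1$ for $ijk=123,145,176,246,257,347,365$ (and $0$ for triples that are not permutations of these). $\|\cdot\|$ is the Euclidean norm on $O\cong\mathbb{R}^8$. For $x=\sum_{i=0}^7 x_ie_i$ and $i\in\{1,\dots,7\}$ put $\zeta_i(x)=x_i-e_ix_0$ (real numbers are identified with multiples of $e_0$). For $\nu=(n_1,\dots,n_7)\in\mathbb{Z}_{\ge0}^7$ put $\|\nu\|=n_1+\cdots+n_7=n$, $\binom{n}{\nu}=\frac{n!}{n_1!\cdots n_7!}$ and $$V_\nu(x)=\frac1{n!}\sum_{(i_1,\dots,i_n)}\bigl(\cdots((\zeta_{i_1}(x)\zeta_{i_2}(x))\zeta_{i_3}(x))\cdots\bigr)\zeta_{i_n}(x),$$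 the sum being over all words $(i_1,\dots,i_n)$ having exactly $n_s$ letters equal to $s$ for each $s=1,\dots,7$, with products bracketed from the left (the product over the empty word is $1$). The auxiliary norm on $O$ is $\|v_0+\sum_{i=1}^7e_iv_i\|_O'=\max_{i\in\{1,\dots,7\}}\|v_i-e_iv_0\|=\max_{i\in\{1,\dots,7\}}\sqrt{v_i^2+v_0^2}$. Conventions: $1/\sigma=\infty$ if $\sigma=0$ (the set is then all of $O$) and $1/\sigma=0$ if $\sigma=\infty$ (the set is then empty). A series $\sum_n\sum_{\|\nu\|=n}V_\nu c_\nu$ converges compactly on an open set if its partial sums over $n\le N$ converge, as $N\to\infty$, uniformly on every compact subset of that set. *)

(* Defs.v *)
From HB Require Import structures.
From mathcomp Require Import all_boot all_order all_algebra.
From mathcomp Require Import all_classical all_reals all_analysis.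

Set Implicit Arguments.
Unset Strict Implicit.
Unset Printing Implicit Defensive.

Import Order.TTheory GRing.Theory Num.Theory.
Import numFieldNormedType.Exports.

Local Open Scope classical_set_scope.
Local Open Scope ring_scope.

Definition eps_triples : seq (nat * nat * nat) :=
  [:: (1, 2, 3); (1, 4, 5); (1, 7, 6); (2, 4, 6); (2, 5, 7); (3, 4, 7);
      (3, 6, 5)]%N.

Definition eps_pos (i j k : nat) : bool :=
  [|| (i, j, k) \in eps_triples, (j, k, i) \in eps_triples
    | (k, i, j) \in eps_triples].

(* The totally antisymmetric tensor: the even permutations of three indices
   are the cyclic ones, and swapping the first two gives the odd ones. *)
Definition eps (R : realType) (i j k : nat) : R :=
  (eps_pos i j k)%:R - (eps_pos j i k)%:R.

(* The library equips row vectors with the maximum norm, whose topology and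
   uniform structure on R^8 are those of the Euclidean norm. *)
Notation octonion R := 'rV[R]_8.

Definition oe (R : realType) (i : 'I_8) : octonion R := delta_mx 0 i.

Definition oone (R : realType) : octonion R := oe R ord0.

Definition oe_mul (R : realType) (i j : 'I_8) : octonion R :=
  if i == ord0 then oe R j
  else if j == ord0 then oe R i
  else - (i == j)%:R *: oe R ord0 + \sum_(k : 'I_8 | k != ord0) eps R i j k *: oe R k.

Definition omul (R : realType) (x y : octonion R) : octonion R :=
  \sum_(i < 8) \sum_(j < 8) (x 0 i * y 0 j) *: oe_mul R i j.

Definition onorm (R : realType) (x : octonion R) : R :=
  Num.sqrt (\sum_(i < 8) x 0 i ^+ 2).

(* The index s : 'I_7 stands for the imaginary unit e_(s+1), that is
   oe R (lift ord0 s). *)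
Definition zeta (R : realType) (s : 'I_7) (x : octonion R) : octonion R :=
  x 0 (lift ord0 s) *: oone R - x 0 ord0 *: oe R (lift ord0 s).

Definition onorm' (R : realType) (x : octonion R) : R :=
  \big[Num.max/0]_(s < 7) onorm (zeta s x).

Definition multi_index := {ffun 'I_7 -> nat}.

Definition mdeg (nu : multi_index) : nat := (\sum_s nu s)%N.

(* A multi-index of degree n has all its entries at most n; see
   mem_multi_indices and uniq_multi_indices. *)
Definition multi_indices (n : nat) : seq multi_index :=
  [seq nu <- [seq [ffun s => nat_of_ord (f s)] | f : {ffun 'I_7 -> 'I_n.+1}]
     | mdeg nu == n].

Lemma mem_multi_indices (n : nat) (nu : multi_index) :
  (nu \in multi_indices n) = (mdeg nu == n).
Proof.
rewrite mem_filter; case: eqP => //= nu_n.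
have le_n s : (nu s < n.+1)%N by rewrite ltnS -nu_n /mdeg (bigD1 s) //= leq_addr.
apply/mapP; exists [ffun s => Ordinal (le_n s)]; first by rewrite mem_enum.
by apply/ffunP => s; rewrite !ffunE.
Qed.

Lemma uniq_multi_indices (n : nat) : uniq (multi_indices n).
Proof.
rewrite filter_uniq // map_inj_uniq ?enum_uniq // => f g /ffunP fg.
by apply/ffunP => s; apply: val_inj; have := fg s; rewrite !ffunE.
Qed.

Definition multinomial_coef (R : realType) (nu : multi_index) : R :=
  (mdeg nu)`!%:R / \prod_(s < 7) (nu s)`!%:R.

Definition V (R : realType) (nu : multi_index) (x : octonion R) : octonion R :=
  (mdeg nu)`!%:R^-1 *:
    \sum_(w : (mdeg nu).-tuple 'I_7 | [forall s, count_mem s w == nu s])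
      foldl (@omul R) (oone R) [seq zeta s x | s <- w].

Definition partial_sum (R : realType) (c : multi_index -> octonion R) (N : nat)
    (x : octonion R) : octonion R :=
  \sum_(0 <= n < N.+1) \sum_(nu <- multi_indices n) omul (V nu x) (c nu).

Definition sigma (R : realType) (c : multi_index -> octonion R) : \bar R :=
  limn_esup (fun n : nat =>
    ((\sum_(nu <- multi_indices n)
        multinomial_coef R nu * onorm (n`!%:R^-1 *: c nu)) `^ (n%:R^-1))%:E).

Definition compactly_cvg (R : realType) (S : nat -> octonion R -> octonion R)
    (h : octonion R -> octonion R) (U : set (octonion R)) : Prop :=
  forall K : set (octonion R), compact K -> K `<=` U ->
    {uniform K, S @ \oo --> h}.

Lemma oe_mulE (R : realType) (i j : 'I_8) :
  omul (oe R i) (oe R j) = oe_mul R i j.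
Proof.
rewrite /omul (bigD1 i) //= [X in _ + X]big1 ?addr0 => [|k ki].
  rewrite (bigD1 j) //= [X in _ + X]big1 ?addr0 => [|k kj].
    by rewrite !mxE !eqxx mulr1 scale1r.
  by rewrite !mxE (negPf kj) mulr0 scale0r.
by rewrite big1 // => l _; rewrite !mxE (negPf ki) mul0r scale0r.
Qed.

Lemma omul1o (R : realType) (x : octonion R) : omul (oone R) x = x.
Proof.
rewrite /omul (bigD1 ord0) //= [X in _ + X]big1 ?addr0 => [|k ki].
  rewrite [RHS]row_sum_delta; apply: eq_bigr => j _.
  by rewrite /oone /oe !mxE !eqxx mul1r /oe_mul eqxx.
by rewrite big1 // => l _; rewrite !mxE (negPf ki) mul0r scale0r.
Qed.

Lemma onorm_zeta (R : realType) (s : 'I_7) (x : octonion R) :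
  onorm (zeta s x) = Num.sqrt (x 0 (lift ord0 s) ^+ 2 + x 0 ord0 ^+ 2).
Proof.
rewrite /onorm (bigD1 ord0) //= (bigD1 (lift ord0 s)) //= big1 => [|i].
  by rewrite !mxE !eqxx /= !(mulr0, mulr1, subr0, sub0r, addr0, sqrrN).
by case/andP=> i0 si; rewrite !mxE (negPf i0) (negPf si) !mulr0 subr0 expr0n.
Qed.

(* Main.v *)
(* The octonion norm is multiplicative (Degen's eight-square identity), so each
   word of length n in the zeta_s(x) has norm at most r^n with r = ||x||'. There
   are at most binom(n, nu) words with content nu, hence the degree n part of
   the series is bounded by a constant times a_n r^n, a_n being the sum under
   the n-th root in sigma. On a compact subset of the domain, ||.||' attains a
   maximum r < 1/sigma; for r < q < 1/sigma eventually a_n q^n <= 1, and the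
   series is dominated there by the geometric series of ratio r/q. *)

From HB Require Import structures.
Require Import Defs.
From mathcomp Require Import all_boot all_order all_algebra.
From mathcomp Require Import all_classical all_reals all_analysis.
From mathcomp Require Import ring lra.
Import numFieldNormedType.Exports.
Import Order.TTheory GRing.Theory Num.Theory.
Local Open Scope classical_set_scope.
Local Open Scope ring_scope.

(** * The multiplication table and the norm of a product *)

(** Structure constants as integers over plain natural indices: unlike [eps R], they evaluate to
    closed values. *)
Definition oe_mul_sign (i j k : nat) : int :=
  if i == 0%N then (j == k)%:R else if j == 0%N then (i == k)%:R
  else if k == 0%N then - (i == j)%:R
  else (eps_pos i j k)%:R - (eps_pos j i k)%:R.

Lemma oe_mul_coord (R : realType) (i j k : 'I_8) :
  oe_mul R i j 0 k = (oe_mul_sign i j k)%:~R.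
Proof.
rewrite /oe_mul /oe_mul_sign -!val_eqE /=.
case: eqP => _; first by rewrite !mxE eqxx eq_sym rmorph_nat.
case: eqP => _; first by rewrite !mxE eqxx eq_sym rmorph_nat.
rewrite !mxE summxE eqxx -!val_eqE /=.
have [k0|k0] := eqVneq (k : nat) 0%N.
  rewrite mulr1 big1 ?addr0 ?rmorphN ?rmorph_nat// => l; apply: contraNeq.
  rewrite !mxE eqxx /=.
  by case: (k =P l) => [<- _|_]; [rewrite -val_eqE /= k0 | rewrite mulr0 eqxx].
rewrite mulr0 add0r (bigD1 k)//= !mxE !eqxx mulr1 big1 => [|l /andP[_ kl]].
  by rewrite addr0 rmorphB !rmorph_nat.
by rewrite !mxE eq_sym (negPf kl) andbF mulr0.
Qed.

(* The (i, j) for which e_i e_j is e_k or -e_k, with a flag for the minus sign: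
   a closed list for each k, which evaluates. *)
Definition oe_mul_terms (k : nat) : seq (nat * nat * bool) :=
  [seq (i, j, (oe_mul_sign i j k < 0)%R) | i <- iota 0 8,
     j <- [seq j <- iota 0 8 | oe_mul_sign i j k != 0]].

(** Each coordinate of a product thereby becomes an explicit signed sum of eight monomials, one for
    each left index. *)
Lemma omul_coord (R : realType) (x y : octonion R) (k : 'I_8) :
  omul x y 0 k = \sum_(t <- oe_mul_terms k)
    (-1) ^+ t.2 * (x 0 (inord t.1.1) * y 0 (inord t.1.2)).
Proof.
rewrite /oe_mul_terms big_allpairs_dep -[iota 0 8]/(index_iota 0 8) big_mkord.
rewrite /omul summxE; apply: eq_bigr => i _.
rewrite summxE big_filter big_mkord [RHS]big_mkcond /=; apply: eq_bigr => j _.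
rewrite !inord_val mxE oe_mul_coord mulrC.
rewrite /oe_mul_sign.
do 3![case: ifP => _;
  first by case: (_ == _ :> nat); rewrite /= ?(mul0r, mul1r, mulN1r)].
by case: (eps_pos i j k); case: (eps_pos j i k);
  rewrite /= ?(mul0r, mul1r, mulN1r).
Qed.

Lemma onormM (R : realType) (x y : octonion R) :
  onorm (omul x y) = onorm x * onorm y.
Proof.
rewrite /onorm -sqrtrM ?sumr_ge0// => [|i _]; last exact: sqr_ge0.
congr Num.sqrt.
pose a n : R := x 0 (inord n); pose b n : R := y 0 (inord n).
have -> : \sum_(i < 8) x 0 i ^+ 2 = \sum_(i < 8) a i ^+ 2.
  by apply: eq_bigr => i _; rewrite /a inord_val.
have -> : \sum_(i < 8) y 0 i ^+ 2 = \sum_(i < 8) b i ^+ 2.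
  by apply: eq_bigr => i _; rewrite /b inord_val.
transitivity (\sum_(k < 8) (\sum_(t <- oe_mul_terms k)
    (-1) ^+ t.2 * (a t.1.1 * b t.1.2)) ^+ 2).
  by apply: eq_bigr => k _; rewrite omul_coord.
(* Forgetting the bodies leaves a polynomial identity in sixteen free values; evaluating the lists
   below makes it a goal for [ring]. *)
move: a b => a b.
rewrite !big_ord_recl !big_ord0.
do ![match goal with |- context [oe_mul_terms ?k] =>
  let l := eval vm_compute in (oe_mul_terms k) in
  change (oe_mul_terms k) with l end].
rewrite !big_cons !big_nil /= /bump /=
  ?(addr0, mul1r, mulN1r, add1n, expr1, expr0).
ring.
Qed.

(** * Counting words of given content *)

(** Induction on the length: fixing the first letter [x] leaves the permutations of [rem x s], and
    removing one [x] divides the product of factorials by the multiplicity of [x]. The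
    multiplicities sum to [size s]. *)
Lemma size_permutations_count (T : finType) (s : seq T) :
  (size (permutations s) * \prod_(x : T) (count_mem x s)`! = (size s)`!)%N.
Proof.
move Dn: (size s) => n; elim: n s Dn => [|n IHn] s Dn.
  by rewrite (size0nil Dn) /= big1.
rewrite (perm_size (permutationsE _)) ?Dn // size_allpairs_dep factS -{1}Dn.
rewrite sumnE big_map big_distrl /=.
have -> : size s = (\sum_(x <- undup s) count_mem x s)%N.
  rewrite -[LHS](count_predT s) -sum1_count -big_undup_iterop_count.
  by apply: eq_bigr => x _; rewrite Monoid.iteropE iter_addn_0 mul1n.
rewrite big_distrl /= [LHS]big_seq [RHS]big_seq; apply: eq_bigr => x.
rewrite mem_undup => sx.
rewrite -(IHn (rem x s)) ?size_rem ?Dn// mulnCA; congr (_ * _)%N.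
have cnt y : count_mem y s = ((x == y) + count_mem y (rem x s))%N.
  exact: (permP (perm_to_rem sx)).
rewrite (bigD1 x) //= [X in _ = (_ * X)%N](bigD1 x) //= mulnA cnt.
rewrite eqxx add1n factS.
congr (_ * _)%N; apply: eq_bigr => y yx.
by rewrite cnt eq_sym (negPf yx).
Qed.

Lemma card_words_le (T : finType) (n : nat) (nu : T -> nat) :
  (#|[pred w : n.-tuple T | [forall s, count_mem s w == nu s]]|
    * \prod_s (nu s)`! <= n`!)%N.
Proof.
(* All these words are permutations of any one of them. *)
set P := [pred w : _ | _].
have [w0 /= w0P|P0] := pickP P; last by rewrite (eq_card0 P0) mul0n.
have -> : (\prod_s (nu s)`! = \prod_s (count_mem s w0)`!)%N.
  by apply: eq_bigr => s _; rewrite (eqP (forallP w0P s)).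
rewrite -[X in (_ <= X`!)%N](size_tuple w0) -size_permutations_count.
rewrite leq_mul2r; apply/orP; right.
rewrite cardE -(size_map val) uniq_leq_size//.
  by rewrite map_inj_uniq ?enum_uniq//; exact: val_inj.
move=> _ /mapP[w + ->]; rewrite mem_enum mem_permutations => wP.
apply/allP => s _ /=.
by rewrite (eqP (forallP wP s)) (eqP (forallP w0P s)).
Qed.

(** * Uniform Cauchy criterion and root test *)

(* The library does not join the complete and the normed structures of
   matrices. *)
HB.instance Definition _ (R : realType) (m n : nat) :=
  Complete.on 'M[R]_(m, n).

(** Letting [n] tend to infinity in the Cauchy bound keeps it uniform on [K]. Off [K] the value of
    [limn] may be a default, which uniformity on [K] ignores. *)
Lemma uniformly_cauchy_cvg {R : realType} (T : choiceType)
    (E : completeNormedModType R) (S : nat -> T -> E) (K : set T) :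
  (forall e, 0 < e -> \forall N \near \oo, forall n x, (N <= n)%N -> K x ->
     `|S n x - S N x| <= e) ->
  {uniform K, S @ \oo --> (fun x => limn (S ^~ x))}.
Proof.
move=> SK.
have cvgS x : K x -> cvgn (S ^~ x).
  move=> Kx; apply/cauchy_cvgP/cauchy_ballP => e e0.
  (* Two comparisons with [S N] cost [e / 2], leaving room for the strict inequality of the ball. *)
  have e40 : 0 < e / 4 by rewrite divr_gt0.
  have [N _ SN] := SK _ e40.
  rewrite near_map2; near=> m n => /=; rewrite -ball_normE /ball_ /=.
  have {}SN p : (N <= p)%N -> `|S p x - S N x| <= e / 4.
    by move=> Np; exact: SN (leqnn N) p x Np Kx.
  have -> : S m x - S n x = (S m x - S N x) - (S n x - S N x).
    by rewrite opprB addrA subrK.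
  apply: le_lt_trans (ler_normB _ _) _.
  apply: (@le_lt_trans _ _ (e / 4 + e / 4)); last lra.
  by apply: lerD; apply: SN; [near: m|near: n]; exact: nbhs_infty_ge.
move=> P /uniform_nbhs[A [/= entA AP]].
move: entA; rewrite -entourage_ballE => -[e /= e0 eA].
have e20 : 0 < e / 2 by rewrite divr_gt0.
have := SK _ e20; apply: filterS => N SN; apply: AP => x Kx /=.
apply: eA; rewrite /= -ball_normE /ball_ /=.
have cS := cvgS x Kx.
apply: (@le_lt_trans _ _ (e / 2)); last lra.
have : (fun n => `|S n x - S N x|) @ \oo --> `|limn (S ^~ x) - S N x|.
  by apply: cvg_norm; apply: cvgB => //; exact: cvg_cst.
move/cvgr_to_le; apply; near=> n; apply: SN => //; near: n.
exact: nbhs_infty_ge.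
Unshelve. all: by end_near. Qed.

(** A limsup below the bound puts some tail supremum below it; raising to the [n]-th power removes
    the root. *)
Lemma limn_esup_root_lt {R : realType} (a : nat -> R) (r : R) :
  (forall n, 0 <= a n) -> 0 < r ->
  (limn_esup (fun n => (a n `^ n%:R^-1)%:E) < (r^-1)%:E)%E ->
  \forall n \near \oo, a n * r ^+ n <= 1.
Proof.
move=> a0 r0 /ereal_inf_lt[_ [A [N _ NA] <-] supA].
near=> n.
(* For [n = 0] the exponent [n%:R^-1] is 0, and the power would not undo the root. *)
have n0 : (0 < n)%N by near: n; exact: nbhs_infty_gt.
have : ((a n `^ n%:R^-1)%:E < (r^-1)%:E)%E.
  apply: le_lt_trans supA; apply: ereal_sup_ubound; exists n => //.
  by apply: NA; near: n; exact: nbhs_infty_ge.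
rewrite lte_fin => /ltW ar.
rewrite -ler_pdivlMr ?exprn_gt0// mul1r -exprVn.
have -> : a n = (a n `^ n%:R^-1) ^+ n.
  by rewrite -powR_mulrn ?powR_ge0// -powRrM mulVf ?pnatr_eq0 -?lt0n// powRr1.
by rewrite lerXn2r// nnegrE ?powR_ge0// invr_ge0 ltW.
Unshelve. all: by end_near. Qed.

(** Supplies the radius of the comparison series. When [s = 0] the inverse is [+oo], and [r + 1]
    serves. *)
Lemma exists_between_inve {R : realType} (s : \bar R) (r : R) :
  (0 <= s)%E -> 0 <= r ->
  (r%:E < s^-1)%E -> exists q, [/\ r < q, 0 < q & (s < (q^-1)%:E)%E].
Proof.
move=> s0 r0 rs; have [q rq qs] : exists2 q, r < q & (q%:E < s^-1)%E.
  case: (s^-1)%E rs => [t||]; rewrite ?ltNye//.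
    rewrite lte_fin => rt; exists ((r + t) / 2); rewrite ?lte_fin; lra.
  by exists (r + 1); rewrite ?ltry//; lra.
have q0 : 0 < q by exact: le_lt_trans rq.
exists q; split => //; move: qs.
by rewrite inve_pgt ?inE ?lee_fin// ?ltW// inver gt_eqF.
Qed.

(** * Bounds on the homogeneous terms *)

Lemma onorm_ge0 {R : realType} (x : octonion R) : 0 <= onorm x.
Proof. exact: sqrtr_ge0. Qed.

Lemma onormZ {R : realType} (k : R) (x : octonion R) :
  onorm (k *: x) = `|k| * onorm x.
Proof.
rewrite /onorm -sqrtr_sqr -sqrtrM ?sqr_ge0// mulr_sumr.
by congr Num.sqrt; apply: eq_bigr => i _; rewrite mxE exprMn.
Qed.

Lemma onorm_oone (R : realType) : onorm (oone R) = 1.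
Proof.
rewrite /onorm (bigD1 ord0) //= big1 => [|i i0].
  by rewrite !mxE !eqxx expr1n addr0 sqrtr1.
by rewrite !mxE (negPf i0) andbF expr0n.
Qed.

Lemma norm_le_onorm {R : realType} (x : octonion R) : `|x| <= onorm x.
Proof.
rewrite (mx_normrE x : `|x| = _); apply/bigmax_leP.
split=> [|[i j] _ /=]; first exact: onorm_ge0.
rewrite ord1 -sqrtr_sqr ler_sqrt ?sumr_ge0// => [|k _]; last exact: sqr_ge0.
by rewrite (bigD1 j)//= lerDl sumr_ge0// => k _; exact: sqr_ge0.
Qed.

Lemma onorm_le_norm {R : realType} (x : octonion R) : onorm x <= 8 * `|x|.
Proof.
rewrite -[leRHS]ger0_norm ?mulr_ge0// -sqrtr_sqr ler_sqrt ?sqr_ge0//.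
(* Eight squares give at most 8 times the squared maximum norm, and 8 is below the square of 8; the
   crude constant avoids a square root. *)
apply: (@le_trans _ _ (\sum_(i < 8) `|x| ^+ 2)).
  apply: ler_sum => i _; rewrite -real_normK ?num_real// lerXn2r ?nnegrE//.
  by rewrite [leRHS](mx_normrE x); exact: (le_bigmax _ _ (0, i)).
rewrite sumr_const card_ord exprMn -[leLHS]mulr_natl ler_wpM2r ?sqr_ge0//; lra.
Qed.

(** The mixed form fits the use: [V] is bounded in the maximum norm, while [sigma] measures the
    coefficients by [onorm]. *)
Lemma norm_omul_le {R : realType} (x y : octonion R) :
  `|omul x y| <= 8 * `|x| * onorm y.
Proof.
apply: le_trans (norm_le_onorm _) _.
by rewrite onormM ler_wpM2r ?onorm_ge0 ?onorm_le_norm.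
Qed.

Lemma onorm'_ge0 {R : realType} (x : octonion R) : 0 <= onorm' x.
Proof. exact: bigmax_ge_id. Qed.

Lemma onorm_zeta_le {R : realType} (s : 'I_7) (x : octonion R) :
  onorm (zeta s x) <= onorm' x.
Proof. exact: le_bigmax. Qed.

(** An arbitrary start [p] lets the induction follow the accumulator of [foldl]; multiplicativity of
    [onorm] makes the bracketing harmless. *)
Lemma onorm_word_le {R : realType} (w : seq 'I_7) (x p : octonion R) :
  onorm (foldl (@omul R) p [seq zeta s x | s <- w])
    <= onorm p * onorm' x ^+ size w.
Proof.
elim: w p => [|s w IHw] p /=; first by rewrite mulr1.
apply: le_trans (IHw _) _; rewrite onormM exprS mulrA.
rewrite ler_wpM2r ?exprn_ge0 ?onorm'_ge0//.
by rewrite ler_wpM2l ?onorm_ge0 ?onorm_zeta_le.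
Qed.

Lemma norm_V_le {R : realType} (nu : multi_index) (x : octonion R) :
  `|V nu x| <=
    (mdeg nu)`!%:R^-1 * multinomial_coef R nu * onorm' x ^+ mdeg nu.
Proof.
rewrite /V normrZ ger0_norm ?invr_ge0// -mulrA ler_wpM2l ?invr_ge0//.
apply: le_trans (ler_norm_sum _ _ _) _.
apply: (@le_trans _ _ (\sum_(w : (mdeg nu).-tuple 'I_7
    | [forall s, count_mem s w == nu s]) onorm' x ^+ mdeg nu)).
  apply: ler_sum => w _; apply: le_trans (norm_le_onorm _) _.
  apply: le_trans (onorm_word_le _ _ _) _.
  by rewrite onorm_oone mul1r size_tuple.
rewrite sumr_const -mulr_natl ler_wpM2r ?exprn_ge0 ?onorm'_ge0//.
rewrite /multinomial_coef -natr_prod ler_pdivlMr; last first.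
  by rewrite ltr0n prodn_gt0// => s; rewrite fact_gt0.
by rewrite -natrM ler_nat card_words_le.
Qed.

Lemma norm_homogeneous_le {R : realType} (c : multi_index -> octonion R)
    (n : nat) (x : octonion R) :
  `|\sum_(nu <- multi_indices n) omul (V nu x) (c nu)| <=
    8 * (\sum_(nu <- multi_indices n)
           multinomial_coef R nu * onorm (n`!%:R^-1 *: c nu)) * onorm' x ^+ n.
Proof.
apply: le_trans (ler_norm_sum _ _ _) _.
rewrite mulr_sumr mulr_suml !big_seq; apply: ler_sum => nu.
rewrite mem_multi_indices => /eqP nun; apply: le_trans (norm_omul_le _ _) _.
have := norm_V_le nu x; rewrite nun onormZ => Vle.
rewrite ger0_norm ?invr_ge0//.
(* The factor 1/n! of [V] is the one that [sigma] attaches to the coefficient. *)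
have -> : 8 * (multinomial_coef R nu * (n`!%:R^-1 * onorm (c nu)))
    * onorm' x ^+ n =
  8 * (n`!%:R^-1 * multinomial_coef R nu * onorm' x ^+ n * onorm (c nu)).
  by ring.
by rewrite -mulrA ler_wpM2l// ler_wpM2r ?onorm_ge0.
Qed.

(** * Continuity of the auxiliary norm and compact convergence *)

Lemma onorm'_continuous (R : realType) : continuous (@onorm' R).
Proof.
apply: continuous_big => [|s _]; first exact: max_continuous.
rewrite (_ : (fun x => _) = fun x : octonion R =>
  Num.sqrt (x 0 (lift ord0 s) ^+ 2 + x 0 ord0 ^+ 2)); last first.
  by apply/funext => x; rewrite onorm_zeta.
have coord_sqr i : continuous (fun x : octonion R => x 0 i ^+ 2).
  move=> x; apply: (@continuous_comp _ _ _ (fun x : octonion R => x 0 i)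
    (fun t : R => t ^+ 2)); [exact: coord_continuous|exact: exprn_continuous].
move=> x; apply: (@continuous_comp _ _ _
  (fun x : octonion R => x 0 (lift ord0 s) ^+ 2 + x 0 ord0 ^+ 2) Num.sqrt);
  last exact: sqrt_continuous.
by apply: continuousD; exact: coord_sqr.
Qed.

Theorem theorem5p0p4 (R : realType) (c : multi_index -> octonion R) :
  let h := fun x : octonion R => limn (fun N : nat => partial_sum c N x) in
  compactly_cvg (partial_sum c) h
    [set x : octonion R | ((onorm' x)%:E < (sigma c)^-1)%E].
Proof.
move=> /= K Kcompact Kball.
apply: (@uniformly_cauchy_cvg R _ (octonion R) (partial_sum c)) => e e0.
(* An empty [K] has no point where a maximum is attained. *)
have [K0|/set0P K0] := eqVneq K set0.
  by apply: nearW => N n x _; rewrite K0.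
have [x0 + x0_max] := compact_EVT_max K0 Kcompact
  (continuous_subspaceT (@onorm'_continuous R)).
rewrite inE => /Kball /= x0_ball.
set a := fun n : nat => \sum_(nu <- multi_indices n)
  multinomial_coef R nu * onorm (n`!%:R^-1 *: c nu).
have a_ge0 n : 0 <= a n.
  apply: sumr_ge0 => nu _; rewrite mulr_ge0 ?onorm_ge0// divr_ge0//.
  by apply: prodr_ge0.
have sigma_ge0 : (0 <= sigma c)%E.
  apply: limf_esup_ge0 => [|n]; first exact: filter_not_empty.
  by rewrite lee_fin powR_ge0.
have [q [x0q q0 sigmaq]] :=
  exists_between_inve _ _ sigma_ge0 (onorm'_ge0 _) x0_ball.
pose z := onorm' x0 / q.
have z_ge0 : 0 <= z by rewrite divr_ge0 ?onorm'_ge0 ?ltW.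
have z1 : `|z| < 1 by rewrite ger0_norm// ltr_pdivrMr// mul1r.
have termle : \forall n \near \oo, forall x, K x ->
    `|\sum_(nu <- multi_indices n) omul (V nu x) (c nu)| <= geometric 8 z n.
  have := limn_esup_root_lt a _ a_ge0 q0 sigmaq.
  apply: filterS => n aq1 x Kx; apply: le_trans (norm_homogeneous_le _ _ _) _.
  rewrite -/(a n) /= -mulrA ler_wpM2l//.
  apply: (@le_trans _ _ (a n * onorm' x0 ^+ n)).
    rewrite ler_wpM2l// lerXn2r ?nnegrE ?onorm'_ge0//.
    by apply: x0_max; rewrite inE.
  (* This turns the bound into [(a n * q ^+ n) * z ^+ n], whose first factor is at most 1. *)
  have -> : onorm' x0 = q * z by rewrite /z mulrC divfK ?gt_eqF.
  by rewrite exprMn mulrA ler_piMl// exprn_ge0.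
have /cauchy_cvgP/cauchy_seriesP /(_ e e0) :=
  @is_cvg_geometric_series R 8 z z1.
move=> [[A1 A2] /= [[N1 _ NA1] [N2 _ NA2]] A12].
case: termle => N3 _ Nterm.
near=> N => n x Nn Kx.
have -> : partial_sum c n x - partial_sum c N x =
    \sum_(N.+1 <= k < n.+1) \sum_(nu <- multi_indices k) omul (V nu x) (c nu).
  by rewrite /partial_sum (big_cat_nat (leq0n N.+1))//= addrAC subrr add0r.
apply: le_trans (ler_norm_sum _ _ _) _.
apply: (@le_trans _ _ (\sum_(N.+1 <= k < n.+1) geometric 8 z k)).
  apply: ler_sum_nat => k /andP[Nk _]; apply: Nterm => //=.
  by apply: leq_trans (ltnW Nk); near: N; exact: nbhs_infty_ge.
(* The Cauchy criterion for the geometric series is taken at [(N.+1, n.+1)], since a partial sum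
   includes its last degree. *)
apply: le_trans (ler_norm _) (ltW _); apply: (A12 (N.+1, n.+1)); split => /=.
  by apply: NA1; rewrite /= leqW//; near: N; exact: nbhs_infty_ge.
apply: NA2; rewrite /= leqW// (leq_trans _ Nn)//.
by near: N; exact: nbhs_infty_ge.
Unshelve. all: by end_near. Qed.
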